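(* Let $F$ be a scalar group, let $V$ and $V'$ be near-vector spaces over $F$, and let $f:V\to V'$ be a linear map. Then $V/\operatorname{Ker}(f)\cong\operatorname{Im}(f)$ as near-vector spaces over $F$.
   Context: A scalar group is a tuple $F=(F,\cdot,1,0,-1)$ where $(F,\cdot,1)$ is a monoid, $0,-1\in F$, $0\cdot\alpha=0=\alpha\cdot 0$ for all $\alpha\in F$, $\{1,-1\}$ is the solution set of the equation $x^2=1$ in $F$, and $(F\setminus\{0\},\cdot,1)$ is a group. An $F$-space is an abelian group $(V,+)$ with a map $F\times V\to V$, $(\alpha,v)\mapsto\alpha\cdot v$, such that for all $\alpha,\beta\in F$, $v,w\in V$: $\alpha\cdot(\beta\cdot v)=(\alpha\cdot\beta)\cdot v$, $1\cdot v=v$, $\alpha\cdot(v+w)=\alpha\cdot v+\alpha\cdot w$, $(-1)\cdot v=-v$, $0\cdot v=0$. The quasi-kernel of an $F$-space $V$ is $Q(V)=\{v\in V\mid \forall \alpha,\beta\in F\ \exists\gamma\in F:\ \alpha\cdot v+\beta\cdot v=\gamma\cdot v\}$. A near-vector space over $F$ is an $F$-space $V$ whose action is free (if $\alpha\cdot v=\beta\cdot v$ then $v=0$ or $\alpha=\beta$) and such that $Q(V)$ generates $V$ as an additive group. A linear map between near-vector spaces over $F$ is a map $f$ with $f(x+y)=f(x)+f(y)$ and $f(\alpha\cdot x)=\alpha\cdot f(x)$; $\operatorname{Ker}(f)=\{v\in V\mid f(v)=0\}$ and $\operatorname{Im}(f)=\{f(v)\mid v\in V\}$. For a nonempty subset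 $W\subseteq V$ closed under addition and scalar multiplication, $V/W$ carries the operations $(v+W)+(w+W)=(v+w)+W$, $\alpha\cdot(v+W)=(\alpha\cdot v)+W$; $\operatorname{Im}(f)$ carries the operations of $V'$. Isomorphism means bijective linear map. *)

(* Defs.v *)
From HB Require Import structures.
From mathcomp Require Import all_boot all_algebra.
From mathcomp Require Import boolp classical_sets.

Set Implicit Arguments.
Unset Strict Implicit.
Unset Printing Implicit Defensive.

Import GRing.Theory.
Local Open Scope ring_scope.
Local Open Scope quotient_scope.

(* The last three fields say that F \ {0} is a group for the multiplication of
   F with unit 1. The case sgN1 = 1 is allowed. *)
HB.mixin Record Monoid_isScalarGroup F of Monoid F := {
  sg0 : F;
  sgN1 : F;
  sg_mul0g : forall a : F, (sg0 * a)%g = sg0;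
  sg_mulg0 : forall a : F, (a * sg0)%g = sg0;
  sg_sqr1 : forall a : F, (a * a)%g = 1%g <-> a = 1%g \/ a = sgN1;
  sg_1_neq0 : (1%g : F) <> sg0;
  sg_mul_neq0 : forall a b : F, a <> sg0 -> b <> sg0 -> (a * b)%g <> sg0;
  sg_inv : forall a : F, a <> sg0 ->
    exists b : F, [/\ b <> sg0, (a * b)%g = 1%g & (b * a)%g = 1%g]
}.

#[short(type="scalarGroupType")]
HB.structure Definition ScalarGroup := {F of Monoid_isScalarGroup F & Monoid F}.

HB.mixin Record Zmodule_isFSpace (F : scalarGroupType) V of GRing.Zmodule V := {
  act : F -> V -> V;
  actA : forall (a b : F) (v : V), act a (act b v) = act (a * b)%g v;
  act1 : forall v : V, act 1%g v = v;
  actDr : forall (a : F) (v w : V), act a (v + w) = act a v + act a w;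
  actN1 : forall v : V, act sgN1 v = - v;
  act0 : forall v : V, act sg0 v = 0
}.

#[short(type="fSpaceType")]
HB.structure Definition FSpace (F : scalarGroupType) :=
  {V of Zmodule_isFSpace F V & GRing.Zmodule V}.

Notation "a **: v" := (act a v) (at level 40, left associativity) : ring_scope.

Lemma actr0 (F : scalarGroupType) (V : fSpaceType F) (a : F) :
  a **: (0 : V) = 0.
Proof. by rewrite -(act0 (0 : V)) actA sg_mulg0. Qed.

Lemma actrN (F : scalarGroupType) (V : fSpaceType F) (a : F) (v : V) :
  a **: (- v) = - (a **: v).
Proof. by apply/eqP; rewrite -addr_eq0 -actDr addNr actr0. Qed.

Section NearVectorSpaces.
Variable F : scalarGroupType.
Implicit Types V U : fSpaceType F.

Definition quasi_kernel (V : fSpaceType F) : set V :=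
  [set v | forall a b : F, exists c : F, a **: v + b **: v = c **: v]%classic.

Definition free_action V : Prop :=
  forall (a b : F) (v : V), a **: v = b **: v -> v = 0 \/ a = b.

Definition generated_subgroup V (A : set V) : set V :=
  smallest (fun S : set V => zmod_closed [in S]) A.

Definition near_vector_space V : Prop :=
  free_action V /\ generated_subgroup (@quasi_kernel V) = [set: V]%classic.

Definition linear_map V U (f : V -> U) : Prop :=
  (forall x y : V, f (x + y) = f x + f y) /\
  (forall (a : F) (x : V), f (a **: x) = a **: f x).

Definition isomorphic V U : Prop :=
  exists f : V -> U, linear_map f /\ bijective f.

Record subspace V := Subspace {
  subspace_pred :> {pred V};
  subspace_nonempty : exists v : V, v \in subspace_pred;
  subspaceD : forall v w : V, v \in subspace_pred -> w \in subspace_pred ->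
    v + w \in subspace_pred;
  subspaceZ : forall (a : F) (v : V), v \in subspace_pred ->
    a **: v \in subspace_pred
}.

End NearVectorSpaces.

Arguments quasi_kernel {F} V.
Arguments isomorphic {F} V U.

Section SubAndQuotient.
Variables (F : scalarGroupType) (V : fSpaceType F) (W : subspace V).

Lemma subspace_zmod_closed : zmod_closed W.
Proof.
split=> [|u v uW vW]; last by rewrite -actN1 subspaceD ?subspaceZ.
by case: (subspace_nonempty W) => v vW; rewrite -(act0 v) subspaceZ.
Qed.

HB.instance Definition _ :=
  GRing.isZmodClosed.Build V (subspace_pred W) subspace_zmod_closed.

Record subspace_type := SubspaceElt {
  subspace_val : V;
  subspace_valP : subspace_val \in subspace_pred W
}.

HB.instance Definition _ := [isSub for subspace_val].
HB.instance Definition _ := [Choice of subspace_type by <:].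
HB.instance Definition _ :=
  GRing.SubChoice_isSubZmodule.Build V _ subspace_type subspace_zmod_closed.

Definition subspace_act (a : F) (w : subspace_type) : subspace_type :=
  SubspaceElt (subspaceZ a (subspace_valP w)).

Fact subspace_actA (a b : F) w :
  subspace_act a (subspace_act b w) = subspace_act (a * b)%g w.
Proof. by apply: val_inj; rewrite /= actA. Qed.

Fact subspace_act1 w : subspace_act 1%g w = w.
Proof. by apply: val_inj; rewrite /= act1. Qed.

Fact subspace_actDr (a : F) v w :
  subspace_act a (v + w) = subspace_act a v + subspace_act a w.
Proof. by apply: val_inj; rewrite /= actDr. Qed.

Fact subspace_actN1 w : subspace_act sgN1 w = - w.
Proof. by apply: val_inj; rewrite /= actN1. Qed.

Fact subspace_act0 w : subspace_act sg0 w = 0.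
Proof. by apply: val_inj; rewrite /= act0. Qed.

HB.instance Definition _ := Zmodule_isFSpace.Build F subspace_type
  subspace_actA subspace_act1 subspace_actDr subspace_actN1 subspace_act0.

(* [Quotient.quot W] is the library's quotient of an additive group by a subgroup;
   lemma pi_quotient_act states that the action on it is a.(v + W) = a.v + W. *)
Definition quotient_space : Type :=
  Quotient.quot (subspace_pred W : zmodClosed V).

HB.instance Definition _ := GRing.Zmodule.on quotient_space.

Definition quotient_pi (v : V) : quotient_space :=
  \pi_(Quotient.quot (subspace_pred W)) v.

Definition quotient_act (a : F) (q : quotient_space) : quotient_space :=
  quotient_pi (a **: repr (q : (Quotient.quot (subspace_pred W)))).

Lemma quotient_piE (v w : V) : quotient_pi v = quotient_pi w <-> v - w \in W.
Proof. by rewrite Quotient.idealrBE; split=> [/eqP|/eqP]. Qed.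

Lemma quotient_piD (v w : V) : quotient_pi (v + w) = quotient_pi v + quotient_pi w.
Proof. exact: raddfD. Qed.

Lemma quotient_piP (q : quotient_space) : exists v : V, q = quotient_pi v.
Proof.
by exists (repr (q : (Quotient.quot (subspace_pred W)))); rewrite /quotient_pi reprK.
Qed.

Lemma pi_quotient_act (a : F) (v : V) :
  quotient_act a (quotient_pi v) = quotient_pi (a **: v).
Proof.
apply/quotient_piE.
rewrite -actrN -actDr subspaceZ //; apply/quotient_piE.
by rewrite /quotient_pi reprK.
Qed.

Fact quotient_actA (a b : F) q :
  quotient_act a (quotient_act b q) = quotient_act (a * b)%g q.
Proof. by case: (quotient_piP q) => v ->; rewrite !pi_quotient_act actA. Qed.

Fact quotient_act1 q : quotient_act 1%g q = q.
Proof. by case: (quotient_piP q) => v ->; rewrite pi_quotient_act act1. Qed.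

Fact quotient_actDr (a : F) p q :
  quotient_act a (p + q) = quotient_act a p + quotient_act a q.
Proof.
case: (quotient_piP p) (quotient_piP q) => v -> [w ->].
by rewrite -quotient_piD !pi_quotient_act actDr quotient_piD.
Qed.

Fact quotient_actN1 q : quotient_act sgN1 q = - q.
Proof.
case: (quotient_piP q) => v ->; rewrite pi_quotient_act actN1.
exact: raddfN.
Qed.

Fact quotient_act0 q : quotient_act sg0 q = 0.
Proof.
case: (quotient_piP q) => v ->; rewrite pi_quotient_act act0.
exact: raddf0.
Qed.

HB.instance Definition _ := Zmodule_isFSpace.Build F quotient_space
  quotient_actA quotient_act1 quotient_actDr quotient_actN1 quotient_act0.

End SubAndQuotient.

Section KernelImage.
Variables (F : scalarGroupType) (V U : fSpaceType F) (f : V -> U).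
Hypothesis f_lin : linear_map f.

Definition ker_pred : {pred V} := [pred v | f v == 0].
Definition im_pred : {pred U} := [pred u | `[< exists v : V, f v = u >]].

Fact linear_map0 : f 0 = 0.
Proof. by rewrite -(act0 (0 : V)) f_lin.2 act0. Qed.

Fact ker_nonempty : exists v : V, v \in ker_pred.
Proof. by exists 0; rewrite inE linear_map0. Qed.

Fact kerD (v w : V) : v \in ker_pred -> w \in ker_pred -> v + w \in ker_pred.
Proof. by rewrite !inE f_lin.1 => /eqP-> /eqP->; rewrite addr0. Qed.

Fact kerZ (a : F) (v : V) : v \in ker_pred -> a **: v \in ker_pred.
Proof. by rewrite !inE f_lin.2 => /eqP->; rewrite actr0. Qed.

Definition Ker : subspace V := Subspace ker_nonempty kerD kerZ.

Lemma im_predP (u : U) : reflect (exists v : V, f v = u) (u \in im_pred).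
Proof. exact: asboolP. Qed.

Fact im_nonempty : exists u : U, u \in im_pred.
Proof. by exists (f 0); apply/im_predP; exists 0. Qed.

Fact imD (u w : U) : u \in im_pred -> w \in im_pred -> u + w \in im_pred.
Proof.
move=> /im_predP[x <-] /im_predP[y <-].
by apply/im_predP; exists (x + y); rewrite f_lin.1.
Qed.

Fact imZ (a : F) (u : U) : u \in im_pred -> a **: u \in im_pred.
Proof.
move=> /im_predP[x <-].
by apply/im_predP; exists (a **: x); rewrite f_lin.2.
Qed.

Definition Im : subspace U := Subspace im_nonempty imD imZ.

End KernelImage.

(* Main.v *)
Require Import Defs.
From mathcomp Require Import all_boot all_algebra.
From mathcomp Require Import boolp classical_sets.

(** Linear maps send quasi-kernels into quasi-kernels, so a surjective linear
    map carries generation by the quasi-kernel forward, while an injective one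
    pulls freeness of the action back. Hence the image inherits freeness from
    [V'] and generation from [V], whereas the quotient inherits generation from
    [V] and freeness from the image, into which it embeds by [v + Ker f |-> f v]. *)

Import GRing.Theory.
Local Open Scope ring_scope.

Section LinearMaps.
Variables (F : scalarGroupType) (V U : fSpaceType F) (f : V -> U).
Hypothesis f_lin : linear_map f.

Lemma linear_mapB (x y : V) : f (x - y) = f x - f y.
Proof. by rewrite -(actN1 y) f_lin.1 f_lin.2 actN1. Qed.

Lemma linear_map_quasi_kernel (v : V) :
  quasi_kernel V v -> quasi_kernel U (f v).
Proof.
by move=> Qv a b; have [c e] := Qv a b; exists c; rewrite -!f_lin.2 -f_lin.1 e.
Qed.

Lemma injective_linear_map_free : injective f -> free_action U -> free_action V.
Proof.
move=> f_inj Ufree a b v abv.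
have /Ufree[fv0|->] : a **: f v = b **: f v by rewrite -!f_lin.2 abv.
  by left; apply: f_inj; rewrite fv0 linear_map0.
by right.
Qed.

(** If a subgroup [S] contains the quasi-kernel of [U], then its preimage under [f] is a subgroup
    containing the quasi-kernel of [V], hence all of [V]; surjectivity then puts every [u] in
    [S]. *)
Lemma surjective_linear_map_generated : (forall u, exists v, f v = u) ->
  generated_subgroup (quasi_kernel V) = [set: V]%classic ->
  generated_subgroup (quasi_kernel U) = [set: U]%classic.
Proof.
move=> f_surj Vgen; apply/seteqP; split=> // u _ S [[S0 SB] QS].
have [v <-] := f_surj u.
have /(_ (f @^-1` S)%classic) : generated_subgroup (quasi_kernel V) v.
  by rewrite Vgen.
apply; split; last by move=> w /linear_map_quasi_kernel/QS.
split=> [|x y]; first by rewrite !inE /= linear_map0 //; rewrite !inE in S0.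
rewrite !inE /= => Sx Sy; rewrite linear_mapB.
by have := SB (f x) (f y); rewrite !inE; apply.
Qed.

Definition im_corestrict (v : V) : subspace_type (Im f_lin) :=
  @SubspaceElt F U (Im f_lin) (f v) (introT (im_predP f (f v)) (ex_intro _ v erefl)).

Lemma im_corestrict_linear : linear_map im_corestrict.
Proof.
by split=> [x y|a x]; apply: val_inj; rewrite /= (f_lin.1, f_lin.2).
Qed.

Lemma im_corestrict_surj w : exists v, im_corestrict v = w.
Proof.
by case: w => u u_im; have /im_predP[v fv] := u_im; exists v; apply: val_inj.
Qed.

(** Built on a chosen representative of each class; [quotient_to_im_pi] shows that the choice does
    not matter. *)
Definition quotient_to_im (q : quotient_space (Ker f_lin)) :
    subspace_type (Im f_lin) :=
  im_corestrict (repr (q : Quotient.quot (subspace_pred (Ker f_lin)))).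

Lemma quotient_to_im_pi (v : V) :
  quotient_to_im (quotient_pi (Ker f_lin) v) = im_corestrict v.
Proof.
apply: val_inj => /=; apply/eqP; rewrite -subr_eq0 -linear_mapB.
(* The remaining goal is, by conversion, membership in the kernel of the chosen representative minus
   [v]. *)
suff: repr (quotient_pi (Ker f_lin) v
  : Quotient.quot (subspace_pred (Ker f_lin))) - v \in Ker f_lin by [].
by apply/quotient_piE; rewrite /quotient_pi reprK.
Qed.

Lemma quotient_to_im_linear : linear_map quotient_to_im.
Proof.
split=> [p q|a p]; have [v ->] := quotient_piP p.
  have [w ->] := quotient_piP q.
  by rewrite -quotient_piD !quotient_to_im_pi im_corestrict_linear.1.
have -> : a **: quotient_pi (Ker f_lin) v = quotient_pi (Ker f_lin) (a **: v).
  exact: pi_quotient_act.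
by rewrite !quotient_to_im_pi im_corestrict_linear.2.
Qed.

Lemma quotient_to_im_inj : injective quotient_to_im.
Proof.
move=> p q; have [v ->] := quotient_piP p; have [w ->] := quotient_piP q.
(* Equal elements of the image have equal values, so [f v = f w] and [v - w] lies in the kernel. *)
rewrite !quotient_to_im_pi => -[fvw]; apply/quotient_piE.
by rewrite inE linear_mapB fvw subrr.
Qed.

Lemma quotient_to_im_bij : bijective quotient_to_im.
Proof.
have surj w : exists q, quotient_to_im q = w.
  have [v <-] := im_corestrict_surj w.
  by exists (quotient_pi (Ker f_lin) v); rewrite quotient_to_im_pi.
(* Choice gives a right inverse [g]; injectivity makes it a left inverse too. *)
have [g gK] := choice surj.
by exists g => // q; apply: quotient_to_im_inj; rewrite gK.
Qed.

End LinearMaps.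

Theorem theorem4p5 (F : scalarGroupType) (V V' : fSpaceType F)
    (hV : near_vector_space V) (hV' : near_vector_space V')
    (f : V -> V') (hf : linear_map f) :
  [/\ near_vector_space (quotient_space (Ker hf)),
      near_vector_space (subspace_type (Im hf))
    & isomorphic (quotient_space (Ker hf)) (subspace_type (Im hf))].
Proof.
have [[_ Vgen] [V'free _]] := (hV, hV').
have Im_free : free_action (subspace_type (Im hf)).
  (* The injective map used here is the inclusion of the image into [V']. *)
  apply: (@injective_linear_map_free _ _ _ (@subspace_val _ _ _)) => //.
  exact: val_inj.
have pi_lin : linear_map (quotient_pi (Ker hf)).
  by split=> [|a v]; [exact: quotient_piD | rewrite -pi_quotient_act].
split; first split.
- apply: injective_linear_map_free Im_free; first exact: quotient_to_im_linear.
  exact: quotient_to_im_inj.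
- apply: (surjective_linear_map_generated _ _ _ _ pi_lin) Vgen => q.
  by have [v ->] := quotient_piP q; exists v.
- split=> //; apply: surjective_linear_map_generated Vgen.
    exact: im_corestrict_linear.
  exact: im_corestrict_surj.
- exists (quotient_to_im _ _ _ _ hf); split.
    exact: quotient_to_im_linear.
  exact: quotient_to_im_bij.
Qed.
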